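(* Let $k$ be a commutative ring, let $A$ be a commutative $k$-algebra and let $m\geq 2$ be an integer which is invertible in $k$. Then every Hasse-Schmidt derivation $D\in\operatorname{HS}_k(A;m-1)$ of length $m-1$ is $m$-integrable.
   Context: For a commutative ring $k$, a commutative $k$-algebra $A$ and an integer $m\geq 1$, a Hasse-Schmidt derivation of $A$ over $k$ of length $m$ is a sequence $D=(D_0,D_1,\ldots,D_m)$ of $k$-linear maps $D_n:A\to A$ with $D_0=\mathrm{Id}_A$ and $D_n(xy)=\sum_{i+j=n}D_i(x)D_j(y)$ for all $x,y\in A$ and all $n\le m$. The set of these is $\operatorname{HS}_k(A;m)$. For $n\geq m$, $D\in \operatorname{HS}_k(A;m)$ is called $n$-integrable if there exists $E\in\operatorname{HS}_k(A;n)$ with $E_i=D_i$ for all $i\leq m$. *)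

(* Defs.v *)
From HB Require Import structures.
From mathcomp Require Import all_boot all_algebra.

Set Implicit Arguments.
Unset Strict Implicit.
Unset Printing Implicit Defensive.

Import GRing.Theory.
Local Open Scope ring_scope.

(* A commutative k-algebra is given by its structure morphism k -> A, because
   comAlgType requires 1 != 0 and so excludes the zero algebra. The alias
   alg_of iota of A carries its ring structure and the induced k-module
   structure c *: x = iota c * x. *)
Definition alg_of (k A : comPzRingType) (iota : {rmorphism k -> A}) : Type := A.

Section AlgOf.
Variables (k A : comPzRingType) (iota : {rmorphism k -> A}).

HB.instance Definition _ := GRing.ComPzRing.on (alg_of iota).

Definition alg_scale (c : k) (x : alg_of iota) : alg_of iota :=
  (iota c : alg_of iota) * x.

Fact alg_scaleA (a b : k) (x : alg_of iota) :
  alg_scale a (alg_scale b x) = alg_scale (a * b) x.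
Proof. by rewrite /alg_scale rmorphM; apply: mulrA. Qed.

Fact alg_scale1 : left_id 1 alg_scale.
Proof. by move=> x; rewrite /alg_scale rmorph1; apply: mul1r. Qed.

Fact alg_scaleDr : right_distributive alg_scale +%R.
Proof. by move=> a x y; apply: mulrDr. Qed.

Fact alg_scaleDl (x : alg_of iota) : {morph alg_scale^~ x : a b / a + b}.
Proof. by move=> a b; rewrite /alg_scale rmorphD; apply: mulrDl. Qed.

HB.instance Definition _ := GRing.Zmodule_isLmodule.Build k (alg_of iota)
  alg_scaleA alg_scale1 alg_scaleDr alg_scaleDl.

End AlgOf.

Record HS (k A : comPzRingType) (iota : {rmorphism k -> A}) (m : nat) := MkHS {
  HS_map :> 'I_m.+1 -> {linear alg_of iota -> alg_of iota};
  HS_map0 : forall x : alg_of iota, HS_map ord0 x = x;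
  HS_mapM : forall (n : 'I_m.+1) (x y : alg_of iota),
    HS_map n (x * y) =
      \sum_(p : 'I_m.+1 * 'I_m.+1 | (p.1 + p.2)%N == n)
        HS_map p.1 x * HS_map p.2 y
}.

Definition integrable (k A : comPzRingType) (iota : {rmorphism k -> A})
    (m n : nat) (le_mn : (m <= n)%N) (D : HS iota m) : Prop :=
  exists E : HS iota n,
    forall i : 'I_m.+1, E (widen_ord (le_mn : (m < n.+1)%N) i) =1 D i.
Arguments integrable {k A iota m} n le_mn D.

(* Main.v *)
Require Import Defs.
From HB Require Import structures.
From mathcomp Require Import all_boot all_algebra.

Set Implicit Arguments.
Unset Strict Implicit.
Unset Printing Implicit Defensive.

Import GRing.Theory.
Local Open Scope ring_scope.

(** View a Hasse-Schmidt derivation [D] as the series [D(t) = sum_n D_n t^n].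
    Its logarithmic derivative, the series [delta(t)] with
    [t D'(t) = D(t) o delta(t)], that is
    [n D_n = sum_(j <= n) D_(n-j) o delta_j], has coefficients that are
    ordinary derivations.  When only [D_0, ..., D_(m-1)] are given, the
    recursion still produces [delta_1, ..., delta_(m-1)].  Choosing
    [delta_m = 0], the same identity read at [n = m] prescribes [m D_m] in
    terms of known data, and dividing by the single integer [m] gives [D_m].

    Both halves rest on one computation, [log_comp_defect].  Suppose that
    [i D_i = sum_j D_(i-j) o delta_j] for [i < n], and let [R] be the
    difference between the two sides for [i = n].  Then, up to an [n]-fold
    failure of the Leibniz rule for [D_n], the map [R] is a derivation.
    If [D_n] obeys the Leibniz rule, this shows that the next [delta_n] is a
    derivation ([log_derivative_exists]); if instead [D_m] is chosen so that
    [R = 0], it gives [m] times the Leibniz rule for [D_m]. *)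

(** * Sums over triangles *)

Lemma sum_ord_rev (V : nmodType) n (F : nat -> V) :
  \sum_(i < n.+1) F i = \sum_(i < n.+1) F (n - i)%N.
Proof.
by rewrite (reindex_inj rev_ord_inj); apply: eq_bigr => i _ /=; rewrite subSS.
Qed.

Lemma exchange_triangle (V : nmodType) n (G : nat -> nat -> V) :
  \sum_(i < n.+1) \sum_(j < (n - i).+1) G i j =
  \sum_(j < n.+1) \sum_(i < (n - j).+1) G i j.
Proof.
have widen (H : nat -> nat -> V) : \sum_(i < n.+1) \sum_(j < (n - i).+1) H i j =
    \sum_(i < n.+1) \sum_(j < n.+1 | (i + j <= n)%N) H i j.
  apply: eq_bigr => i _; rewrite (big_ord_widen n.+1 (H i)) ?ltnS ?leq_subr //.
  by apply: eq_bigl => j; rewrite ltnS leq_subRL // -ltnS.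
rewrite widen (widen (fun j i => G i j)).
rewrite (exchange_big_dep xpredT) //=; apply: eq_bigr => j _.
by apply: eq_bigl => i; rewrite addnC.
Qed.

Lemma sum_antidiagonal (V : nmodType) m n (F : nat -> nat -> V) : (n <= m)%N ->
  \sum_(p : 'I_m.+1 * 'I_m.+1 | (p.1 + p.2)%N == n) F p.1 p.2 =
  \sum_(i < n.+1) F i (n - i)%N.
Proof.
move=> le_nm.
rewrite (big_ord_widen m.+1 (fun i => F i (n - i)%N)) ?ltnS //.
rewrite -(pair_big_dep xpredT (fun i j : 'I_m.+1 => (i + j)%N == n)
           (fun i j : 'I_m.+1 => F i j)) /=.
rewrite [RHS]big_mkcond; apply: eq_bigr => i _; case: ifP => [|/negbT] le_in.
  rewrite ltnS in le_in.
  have lt_m : (n - i < m.+1)%N by rewrite ltnS (leq_trans (leq_subr _ _)).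
  rewrite (big_pred1 (Ordinal lt_m)) // => j.
  by rewrite /= -[n in LHS](subnKC le_in) eqn_add2l.
rewrite big_pred0 // => j; apply: contraNF le_in => /eqP <-.
by rewrite ltnS leq_addr.
Qed.

(** * The logarithmic derivative *)

Section LogarithmicDerivative.
Variables (k A : comPzRingType) (iota : {rmorphism k -> A}).
Local Notation B := (alg_of iota).

Definition leibniz (d : nat -> {linear B -> B}) n := forall x y,
  d n (x * y) = \sum_(i < n.+1) d i x * d (n - i)%N y.

Definition derivation (f : B -> B) :=
  linear f /\ forall x y, f (x * y) = f x * y + x * f y.

(** The degree [n] coefficient of the composite series [d(t) o delta(t)]. *)
Definition log_comp (d : nat -> {linear B -> B}) (delta : nat -> B -> B) n x :=
  \sum_(j < n.+1) d (n - j)%N (delta j x).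

Lemma linear_log_comp (d : nat -> {linear B -> B}) (delta : nat -> B -> B) n :
  (forall j, linear (delta j)) -> linear (log_comp d delta n).
Proof.
move=> lin_delta c x y; rewrite /log_comp scaler_sumr -big_split.
by apply: eq_bigr => j _ /=; rewrite lin_delta linearP.
Qed.

(** This is associativity of the convolution product.  As [delta 0] vanishes,
    [d n] is only ever applied to [0] or multiplied by [0], so it may be the
    term that is still to be shown to obey the Leibniz rule. *)
Lemma sum_comp_mul (d : nat -> {linear B -> B}) (delta : nat -> B -> B) n x y :
    (forall i, (i < n)%N -> leibniz d i) -> (forall z, delta 0%N z = 0) ->
  \sum_(j < n.+1) d (n - j)%N (delta j x * y) =
  \sum_(b < n.+1) log_comp d delta (n - b) x * d b y.
Proof.
move=> dM delta0.
transitivity (\sum_(j < n.+1) \sum_(b < (n - j).+1)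
                d (n - j - b)%N (delta j x) * d b y).
  apply: eq_bigr => -[[|j] lt_jn] _ /=.
    rewrite delta0 mul0r linear0 big1 // => b _.
    by rewrite linear0 mul0r.
  rewrite ltnS in lt_jn.
  rewrite dM; last by rewrite -subSn // subSS leq_subr.
  rewrite (sum_ord_rev _ (fun a => d a _ * d (n - j.+1 - a)%N y)).
  by apply: eq_bigr => b _; rewrite subKn // -ltnS.
rewrite (exchange_triangle n
           (fun j b => d (n - j - b)%N (delta j x) * d b y)).
apply: eq_bigr => b _; rewrite mulr_suml; apply: eq_bigr => j _.
by rewrite subnAC.
Qed.

(** By the derivation property of the [delta j], [log_comp d delta n (x * y)]
    is a sum of two convolutions of [d o delta] with [d].  The identities in
    degree below [n] give the product [d_i x * d_(n-i) y] the weight [i] in one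
    convolution and [n - i] in the other, [n] in all; the terms with [d 0] as
    the outer factor involve degree [n] and leave the right-hand side. *)
Lemma log_comp_defect (d : nat -> {linear B -> B}) (delta : nat -> B -> B) n x y :
    (forall z, d 0%N z = z) -> (forall i, (i < n)%N -> leibniz d i) ->
    (forall j, derivation (delta j)) -> (forall z, delta 0%N z = 0) ->
    (forall i z, (i < n)%N -> log_comp d delta i z = d i z *+ i) ->
  log_comp d delta n (x * y)
    - (\sum_(i < n.+1) d i x * d (n - i)%N y) *+ n =
  (log_comp d delta n x - d n x *+ n) * y
    + x * (log_comp d delta n y - d n y *+ n).
Proof.
move=> d0 dM der_delta delta0 logE.
have half u v : \sum_(j < n.+1) d (n - j)%N (delta j u * v) =
    (log_comp d delta n u - d n u *+ n) * v
      + \sum_(b < n.+1) (d (n - b)%N u * d b v) *+ (n - b).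
  rewrite sum_comp_mul // !big_ord_recl /= !subn0 d0 mulrBl addrA mulrnAl.
  rewrite subrK; congr (_ + _); apply: eq_bigr => b _.
  by rewrite logE ?mulrnAl // /bump /= subnS prednK ?leq_subr // subn_gt0.
have -> : log_comp d delta n (x * y) =
    \sum_(j < n.+1) d (n - j)%N (delta j x * y)
      + \sum_(j < n.+1) d (n - j)%N (delta j y * x).
  rewrite /log_comp -big_split; apply: eq_bigr => j _ /=.
  by rewrite (der_delta j).2 linearD [x * _]mulrC.
(* The two convolutions carry the weights n - i and i on the same product. *)
have weights : \sum_(b < n.+1) (d (n - b)%N x * d b y) *+ (n - b)
    + \sum_(b < n.+1) (d (n - b)%N y * d b x) *+ (n - b) =
    (\sum_(i < n.+1) d i x * d (n - i)%N y) *+ n.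
  rewrite (sum_ord_rev _ (fun b => (d (n - b)%N x * d b y) *+ (n - b))).
  rewrite -big_split -sumrMnl; apply: eq_bigr => i _ /=.
  have le_in : (i <= n)%N by rewrite -ltnS.
  by rewrite subKn // [d _ y * _]mulrC -mulrnDr subnKC.
by rewrite !half addrACA weights addrK [x * _]mulrC.
Qed.

(** The recursion [delta_n = n D_n - sum_(j < n) D_(n-j) o delta_j].  Extending
    [delta] by zero from [n] on makes the sum for [log_comp d delta n] range
    over [j < n] only. *)
Lemma log_derivative_exists (d : nat -> {linear B -> B}) n :
    (forall z, d 0%N z = z) -> (forall i, (i < n)%N -> leibniz d i) ->
  exists delta : nat -> B -> B,
    [/\ forall j, derivation (delta j), forall z, delta 0%N z = 0,
        forall j z, (n <= j)%N -> delta j z = 0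
      & forall i z, (i < n)%N -> log_comp d delta i z = d i z *+ i].
Proof.
move=> d0; elim: n => [_|n IHn dM].
  exists (fun _ _ => 0); split=> // j; split=> [c x y|x y].
    by rewrite scaler0 addr0.
  by rewrite mul0r mulr0 addr0.
have [i lt_in|delta [der_delta delta0 delta_ge logE]] := IHn.
  by apply: dM; rewrite leqW.
pose delta_n x := d n x *+ n - log_comp d delta n x.
have delta_nE x : delta_n x = - (log_comp d delta n x - d n x *+ n).
  by rewrite opprB.
exists (fun j => if j == n then delta_n else delta j); split.
- move=> j; case: eqP => // _; split=> [c x y|x y].
    rewrite /delta_n linearP linear_log_comp => [|i]; last exact: (der_delta i).1.
    by rewrite mulrnDl opprD addrACA scalerBr scalerMnr.
  rewrite !delta_nE mulNr mulrN -opprD.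
  rewrite -(log_comp_defect _ _ d0 _ der_delta delta0 logE) ?dM // => i lt_in.
  by apply: dM; rewrite leqW.
- move=> z; case: eqP => // n0.
  by rewrite /delta_n -n0 mulr0n /log_comp big_ord1 delta0 linear0 subr0.
- by move=> j z lt_nj; rewrite gtn_eqF // delta_ge // ltnW.
move=> i z; rewrite ltnS leq_eqVlt => /predU1P[-> | lt_in]; last first.
  rewrite -logE //; apply: eq_bigr => j _.
  by rewrite ltn_eqF // (leq_ltn_trans _ lt_in) // -ltnS.
rewrite -[RHS](subrK (log_comp d delta n z)) -/(delta_n z) /log_comp.
rewrite !big_ord_recr /= eqxx subnn !d0 delta_ge // addr0 addrC.
by congr (_ + _); apply: eq_bigr => j _; rewrite ltn_eqF.
Qed.

End LogarithmicDerivative.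

(** * Integrating one step further *)

Theorem lemma2p1 (k A : comPzRingType) (iota : {rmorphism k -> A}) (m : nat)
    (m_ge2 : (2 <= m)%N) (m_inv : exists u : k, u * m%:R = 1)
    (D : HS iota m.-1) :
  integrable m (leq_pred m) D.
Proof.
case: m m_ge2 m_inv D => // m _ [u um1] D.
(* From degree m.+1 on the value of d is arbitrary: in log_comp d delta m.+1
   the term d m.+1 is applied to delta 0 = 0. *)
pose d n : {linear alg_of iota -> alg_of iota} := D (inord n).
have d0 z : d 0%N z = z.
  by rewrite /d (_ : inord 0 = ord0) ?HS_map0 //; apply: val_inj; rewrite /= inordK.
have dE (i : 'I_m.+1) : d i = D i by rewrite /d inord_val.
have dM i : (i < m.+1)%N -> leibniz d i.
  move=> lt_im x y; rewrite (dE (Ordinal lt_im)) HS_mapM.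
  rewrite -(@sum_antidiagonal _ m i (fun i j => d i x * d j y)) //.
  by apply: eq_bigr => p _; rewrite !dE.
have [delta [der_delta delta0 _ logE]] := log_derivative_exists d0 dM.
pose top x := u *: log_comp d delta m.+1 x.
have lin_top : linear top.
  move=> c x y; rewrite /top linear_log_comp => [|j]; last exact: (der_delta j).1.
  by rewrite scalerDr !scalerA mulrC.
pose topL := GRing.isLinear.Build _ _ _ _ top lin_top.
pose top_lin : {linear alg_of iota -> alg_of iota} := HB.pack top topL.
pose e n := if (n < m.+1)%N then d n else top_lin.
have e0 z : e 0%N z = z by rewrite /e /= d0.
have eM i : (i < m.+1)%N -> leibniz e i.
  move=> lt_im x y; rewrite /e lt_im dM //; apply: eq_bigr => j _.
  rewrite !ifT ?(leq_ltn_trans (leq_subr _ _)) //.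
  by rewrite (leq_ltn_trans _ lt_im) // -ltnS.
have e_log i z : (i <= m.+1)%N -> log_comp e delta i z = log_comp d delta i z.
  move=> le_im; apply: eq_bigr => -[[|j] lt_ji] _ /=.
    by rewrite delta0 !linear0.
  rewrite /e ifT // (leq_trans _ le_im) // ltn_subrL /=.
  exact: leq_ltn_trans (leq0n j) lt_ji.
have e_logE i z : (i <= m.+1)%N -> log_comp e delta i z = e i z *+ i.
  move=> le_im; rewrite e_log // /e; case: ltnP => [|le_mi]; first exact: logE.
  have -> : i = m.+1 by apply/eqP; rewrite eqn_leq le_im.
  by rewrite /= /top -scaler_nat scalerA mulrC um1 scale1r.
have e_top : leibniz e m.+1.
  move=> x y.
  have /eqP := log_comp_defect x y e0 eM der_delta delta0
                 (fun i z lt_im => e_logE i z (ltnW lt_im)).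
  rewrite !e_logE // !subrr mul0r mulr0 addr0 subr_eq0 => /eqP /(congr1 ( *:%R u)).
  by rewrite -!scaler_nat !scalerA um1 !scale1r.
have EM (n : 'I_m.+2) x y : e n (x * y) =
    \sum_(p : 'I_m.+2 * 'I_m.+2 | (p.1 + p.2)%N == n) e p.1 x * e p.2 y.
  have le_nm : (n <= m.+1)%N by rewrite -ltnS.
  rewrite (@sum_antidiagonal _ m.+1 n (fun i j => e i x * e j y)) //.
  by move: le_nm; rewrite leq_eqVlt => /predU1P[-> | /eM->].
exists (@MkHS _ _ iota m.+1 (fun i => e i) e0 EM) => i x /=.
by rewrite /e ltn_ord dE.
Qed.
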